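(* Consider the DtP--PSI scheme for the Lax--Friedrichs matrix equation (defined in the context), and let $U^n=X^nS^n(V^n)^T$, $n\ge 0$, be its iterates. If the CFL number $\nu=\lambda_{\max}\frac{\Delta t}{\Delta x}>0$ satisfies $\nu\le \frac13$, then $$\|U^{n+1}\|_F\le \|U^n\|_F\qquad\text{for all } n\ge 0.$$
   Context: Let $A\in\mathbb R^{N_v\times N_v}$ be symmetric, $\lambda_{\max}:=\|A\|_2$ (spectral norm), $\Delta t,\Delta x>0$, and $\nu:=\lambda_{\max}\frac{\Delta t}{\Delta x}>0$. $\|\cdot\|_F$ is the Frobenius norm. Let $E_+,E_-\in\mathbb R^{N_x\times N_x}$ be the periodic shift matrices $(E_+w)_j=w_{j+1}$, $(E_-w)_j=w_{j-1}$ (indices modulo $N_x$), and $M_1=E_+-E_-$, $M_2=2I-E_+-E_-$. For $U\in\mathbb R^{N_x\times N_v}$ set $$F_{\rm LF}(U):=-\frac{1}{2\Delta x}M_1UA-\frac{\lambda_{\max}}{2\Delta x}M_2U .$$ DtP--PSI (discretize-then-project, projector-splitting integrator) scheme of rank $r\le\min(N_x,N_v)$: the state at time level $n$ is $U^n=X^nS^n(V^n)^T$ with $X^n\in\mathbb R^{N_x\times r}$, $S^n\in\mathbb R^{r\times r}$, $V^n\in\mathbb R^{N_v\times r}$, $(X^n)^TX^n=I_r$, $(V^n)^TV^n=I_r$. One step from $n$ to $n+1$ is: K-step: $K^n=X^nS^n$, $K^{n+1}=K^n+\Delta t\,F_{\rm LF}(K^n(V^n)^T)V^n$; take a QR factorization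 $K^{n+1}=X^{n+1}S^{(1)}$ with $X^{n+1}\in\mathbb R^{N_x\times r}$ having orthonormal columns and $S^{(1)}\in\mathbb R^{r\times r}$. S-step: $S^{(2)}=S^{(1)}-\Delta t\,(X^{n+1})^TF_{\rm LF}(X^{n+1}S^{(1)}(V^n)^T)V^n$. L-step: $L^n=S^{(2)}(V^n)^T$, $L^{n+1}=L^n+\Delta t\,(X^{n+1})^TF_{\rm LF}(X^{n+1}L^n)$; take a QR factorization $(L^{n+1})^T=V^{n+1}(S^{n+1})^T$ with $V^{n+1}\in\mathbb R^{N_v\times r}$ having orthonormal columns. Then $U^{n+1}=X^{n+1}S^{n+1}(V^{n+1})^T=X^{n+1}L^{n+1}$. *)

(* Defs.v *)
From HB Require Import structures.
From mathcomp Require Import all_boot all_order all_algebra.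
From mathcomp Require Import all_classical all_reals.

Set Implicit Arguments.
Unset Strict Implicit.
Unset Printing Implicit Defensive.

Import Order.TTheory GRing.Theory Num.Theory.

Local Open Scope ring_scope.
Local Open Scope classical_set_scope.

Section LaxFriedrichsPSI.
Variable R : realType.

(* On column vectors this is the Euclidean norm. *)
Definition frobenius_norm (m n : nat) (B : 'M[R]_(m, n)) : R :=
  Num.sqrt (\sum_(i < m) \sum_(j < n) B i j ^+ 2).

(* Operator norm induced by the Euclidean norms; the supremum is taken over a
   nonempty bounded set. *)
Definition spectral_norm (m n : nat) (B : 'M[R]_(m, n)) : R :=
  sup [set frobenius_norm (B *m v) | v in
        [set v : 'cV[R]_n | frobenius_norm v <= 1]].

Definition orthonormal_cols (m n : nat) (Q : 'M[R]_(m, n)) : Prop :=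
  Q^T *m Q = 1%:M.

(* [is_trig_mx] means lower triangular, so T is required to be upper
   triangular; no sign condition is put on its diagonal. *)
Definition is_QR (m r : nat) (B Q : 'M[R]_(m, r)) (T : 'M[R]_r) : Prop :=
  [/\ B = Q *m T, orthonormal_cols Q & is_trig_mx T^T].

Section Scheme.
Variables Nx Nv r : nat.

(* [ordS] and [ord_pred] are the cyclic successor and predecessor. *)
Definition shift_plus : 'M[R]_Nx := \matrix_(i, j) (j == ordS i)%:R.
Definition shift_minus : 'M[R]_Nx := \matrix_(i, j) (j == ord_pred i)%:R.

Definition M1 : 'M[R]_Nx := shift_plus - shift_minus.
Definition M2 : 'M[R]_Nx := 2%:M - shift_plus - shift_minus.

Variables (A : 'M[R]_Nv) (dt dx : R).

Definition cfl_number : R := spectral_norm A * (dt / dx).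

Definition F_LF (U : 'M[R]_(Nx, Nv)) : 'M[R]_(Nx, Nv) :=
  - ((2 * dx)^-1 *: (M1 *m U *m A))
  - (spectral_norm A / (2 * dx)) *: (M2 *m U).

(* QR factors are not unique, so a step is a relation between (X, S, V) and
   (X', S', V'). *)
Definition psi_step (X : 'M[R]_(Nx, r)) (S : 'M[R]_r) (V : 'M[R]_(Nv, r))
    (X' : 'M[R]_(Nx, r)) (S' : 'M[R]_r) (V' : 'M[R]_(Nv, r)) : Prop :=
  exists S1 : 'M[R]_r,
    let K := X *m S in
    let K' := K + dt *: (F_LF (K *m V^T) *m V) in
    let S2 := S1 - dt *: (X'^T *m F_LF (X' *m S1 *m V^T) *m V) in
    let L := S2 *m V^T in
    let L' := L + dt *: (X'^T *m F_LF (X' *m L)) in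
    is_QR K' X' S1 /\ is_QR L'^T V' S'^T.

(* Orthonormality at the later time levels is part of [psi_step]. *)
Definition psi_iterates (X : nat -> 'M[R]_(Nx, r)) (S : nat -> 'M[R]_r)
    (V : nat -> 'M[R]_(Nv, r)) : Prop :=
  [/\ orthonormal_cols (X 0%N), orthonormal_cols (V 0%N)
    & forall n, psi_step (X n) (S n) (V n) (X n.+1) (S n.+1) (V n.+1)].

End Scheme.
End LaxFriedrichsPSI.

(* Main.v *)
(* Write a = A / |A|_2, c = nu / 2, B = V^T a V, C = V^T a (1 - V V^T), let X be
   the new left factor, S = S1, and K = X S the state after the K-step. With
   T Z = X^T (M1 X Z B + M2 X Z) the S-step multiplies by 1 + c T and the
   L-step, seen in the basis V, by 1 - c T; hence
     |U_new|^2 = |S - c^2 T^2 S|^2 + c^2 |X^T M1 X (S + c T S) C|^2.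
   The S-step runs backward in time and is not a contraction: its growth is paid
   for by the dissipation of the K-step. The latter is a normal operator, so its
   dissipation decreases from one application to the next and can be evaluated
   at K instead of X^n S^n, where it reads 2c q - c^2 (|M1 K B|^2 + |M2 K|^2)
   with the energy q = <K, M2 K>. Everything is then compared with q through
   4 q = |M1 K|^2 + |M2 K|^2. The terms involving T^2 S are controlled by
     <X T S, M2 X T S> <= 12 (|X^T M2 K|^2 + |M2 K|^2 + |(1 - X X^T) M1 K B|^2),
   and these three terms are exactly the slack left in the other estimates; for
   c <= 1/6 the slack suffices. *)
Require Import Defs.
From HB Require Import structures.
From mathcomp Require Import all_boot all_order all_algebra.
From mathcomp Require Import all_classical all_reals.
From mathcomp Require Import ring lra.

Set Implicit Arguments.
Unset Strict Implicit.
Unset Printing Implicit Defensive.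

Import Order.TTheory GRing.Theory Num.Theory.

Local Open Scope ring_scope.

(** * Frobenius inner product, isometries and orthogonal projections *)

Definition dotmx (R : realType) (m n : nat) (Y Z : 'M[R]_(m, n)) : R :=
  \tr (Y^T *m Z).

Local Notation "''[' Y , Z ]" := (dotmx Y Z).
Local Notation "''[' Z ]" := (dotmx Z Z).

Section FrobeniusProduct.
Variable R : realType.

Lemma dotmxE m n (Y Z : 'M[R]_(m, n)) :
  '[Y, Z] = \sum_i \sum_j Y i j * Z i j.
Proof.
rewrite /dotmx /mxtrace exchange_big /=; apply: eq_bigr => j _.
by rewrite mxE; apply: eq_bigr => i _; rewrite mxE.
Qed.

Lemma dotmxC m n (Y Z : 'M[R]_(m, n)) : '[Y, Z] = '[Z, Y].
Proof. by rewrite /dotmx -mxtrace_tr trmx_mul trmxK. Qed.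

Lemma dotmxDr m n (Y Z W : 'M[R]_(m, n)) : '[Y, Z + W] = '[Y, Z] + '[Y, W].
Proof. by rewrite /dotmx mulmxDr mxtraceD. Qed.

Lemma dotmxZr m n a (Y Z : 'M[R]_(m, n)) : '[Y, a *: Z] = a * '[Y, Z].
Proof. by rewrite /dotmx -scalemxAr mxtraceZ. Qed.

Lemma dotmxNr m n (Y Z : 'M[R]_(m, n)) : '[Y, - Z] = - '[Y, Z].
Proof. by rewrite -scaleN1r dotmxZr mulN1r. Qed.

Lemma dotmxDl m n (Y Z W : 'M[R]_(m, n)) : '[Y + Z, W] = '[Y, W] + '[Z, W].
Proof. by rewrite !(dotmxC _ W) dotmxDr. Qed.

Lemma dotmxZl m n a (Y Z : 'M[R]_(m, n)) : '[a *: Y, Z] = a * '[Y, Z].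
Proof. by rewrite !(dotmxC _ Z) dotmxZr. Qed.

Lemma dotmxNl m n (Y Z : 'M[R]_(m, n)) : '[- Y, Z] = - '[Y, Z].
Proof. by rewrite !(dotmxC _ Z) dotmxNr. Qed.

Definition dotmx_lin := (dotmxDl, dotmxDr, dotmxNl, dotmxNr, dotmxZl, dotmxZr).

Lemma dotmx_mull m n p (Q : 'M[R]_(p, m)) (Y : 'M[R]_(m, n)) Z :
  '[Q *m Y, Z] = '[Y, Q^T *m Z].
Proof. by rewrite /dotmx trmx_mul mulmxA. Qed.

Lemma dotmx_mulr m n p (Q : 'M[R]_(n, p)) (Y : 'M[R]_(m, n)) Z :
  '[Y *m Q, Z] = '[Y, Z *m Q^T].
Proof. by rewrite /dotmx trmx_mul -mulmxA mxtrace_mulC mulmxA. Qed.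

Lemma dotmx_ge0 m n (Z : 'M[R]_(m, n)) : 0 <= '[Z].
Proof.
by rewrite dotmxE; do 2!apply: sumr_ge0 => ? _; rewrite -expr2 sqr_ge0.
Qed.

Lemma dotmx_tr m n (Z : 'M[R]_(m, n)) : '[Z^T] = '[Z].
Proof. by rewrite /dotmx trmxK mxtrace_mulC. Qed.

(** The map Z -> D Z B is skew-adjoint for this inner product. *)
Lemma dotmx_skew m n (D : 'M[R]_m) (B : 'M[R]_n) (Z : 'M[R]_(m, n)) :
  D^T = - D -> B^T = B -> '[Z, D *m Z *m B] = 0.
Proof.
move=> DT BT; suff: '[Z, D *m Z *m B] = - '[Z, D *m Z *m B] by lra.
by rewrite {1}dotmxC dotmx_mulr BT dotmx_mull DT mulNmx dotmxNr mulmxA.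
Qed.

Lemma dotmx_isometryl m n p (Q : 'M[R]_(m, p)) (Z : 'M[R]_(p, n)) :
  orthonormal_cols Q -> '[Q *m Z] = '[Z].
Proof. by move=> QQ; rewrite dotmx_mull mulmxA QQ mul1mx. Qed.

Lemma dotmx_isometryr m n p (Q : 'M[R]_(m, p)) (Z : 'M[R]_(n, p)) :
  orthonormal_cols Q -> '[Z *m Q^T] = '[Z].
Proof. by move=> QQ; rewrite dotmx_mulr trmxK -mulmxA QQ mulmx1. Qed.

Lemma dotmx_splitl m n p (Q : 'M[R]_(m, p)) (Z : 'M[R]_(m, n)) :
  orthonormal_cols Q ->
  '[Z] = '[Q^T *m Z] + '[Z - Q *m (Q^T *m Z)].
Proof.
move=> QQ; have e : '[Q *m (Q^T *m Z), Z] = '[Q^T *m Z].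
  by rewrite dotmx_mull.
rewrite !dotmx_lin (dotmxC Z (Q *m _)) e (dotmx_isometryl _ QQ); ring.
Qed.

Lemma dotmx_splitr m n p (Q : 'M[R]_(m, p)) (Z : 'M[R]_(n, m)) :
  orthonormal_cols Q ->
  '[Z] = '[Z *m Q] + '[Z - Z *m Q *m Q^T].
Proof.
move=> QQ; rewrite -(dotmx_tr Z) (dotmx_splitl _ QQ) -trmx_mul dotmx_tr.
congr (_ + _); rewrite -[RHS]dotmx_tr; congr dotmx.
all: by rewrite linearB /= [in RHS]trmx_mul trmxK.
Qed.

Lemma dotmx_projl_le m n p (Q : 'M[R]_(m, p)) (Z : 'M[R]_(m, n)) :
  orthonormal_cols Q -> '[Q^T *m Z] <= '[Z].
Proof. by move=> QQ; rewrite (dotmx_splitl Z QQ) lerDl dotmx_ge0. Qed.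

Lemma dotmx_subZ_sqr m n a (Y Z : 'M[R]_(m, n)) :
  '[Y - a *: Z] = '[Y] - 2 * a * '[Y, Z] + a ^+ 2 * '[Z].
Proof. rewrite !dotmx_lin (dotmxC Z Y); ring. Qed.

(** The gap between the two sides is |2 Y - Z|^2. *)
Lemma dotmx_young m n (Y Z : 'M[R]_(m, n)) :
  2 * '[Y + Z] <= 6 * '[Y] + 3 * '[Z].
Proof.
have := dotmx_ge0 (2 *: Y - Z).
rewrite !dotmx_lin (dotmxC Z Y); lra.
Qed.

End FrobeniusProduct.

(** * Norm decay of one step for abstract commuting [M1] and [M2] *)

Section Contraction.
Variables (R : realType) (m r v : nat) (c : R).
Variables (M1 M2 : 'M[R]_m) (B : 'M[R]_r) (C : 'M[R]_(r, v)).

Hypothesis M1_skew : M1^T = - M1.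
Hypothesis M2_sym : M2^T = M2.
Hypothesis M12C : M1 *m M2 = M2 *m M1.
Hypothesis M2_sqr : M2 *m M2 = 4 *: M2 + M1 *m M1.
Hypothesis M2_ge0 : forall n (Z : 'M[R]_(m, n)), 0 <= '[Z, M2 *m Z].
Hypothesis M2_le4 : forall n (Z : 'M[R]_(m, n)), '[Z, M2 *m Z] <= 4 * '[Z].
Hypothesis B_sym : B^T = B.
Hypothesis BC_le :
  forall n (Z : 'M[R]_(n, r)), '[Z *m B] + '[Z *m C] <= '[Z].
Hypothesis c_gt0 : 0 < c.
Hypothesis c_le : c <= 1 / 6.

Let q n (Z : 'M[R]_(m, n)) := '[Z, M2 *m Z].

(** The right side is <Z, (M2^2 - M1^2) Z>, by skewness of [M1]; then [M2_sqr] applies. *)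
Lemma energyE n (Z : 'M[R]_(m, n)) : 4 * q Z = '[M1 *m Z] + '[M2 *m Z].
Proof.
rewrite !dotmx_mull M1_skew M2_sym !mulmxA M2_sqr !mulNmx.
rewrite mulmxDl -scalemxAl.
rewrite !dotmx_lin /q; ring.
Qed.

(** Inserting M1^2 = M2^2 - 4 M2 gives the exact value 4 |M2 Z|^2 - q (M2 Z). Unlike in [M2_le4],
    the bound contains M2 Z in place of M1 Z. *)
Lemma energyM1_le n (Z : 'M[R]_(m, n)) : q (M1 *m Z) <= 4 * '[M2 *m Z].
Proof.
have e : q (M1 *m Z) = 4 * '[M2 *m Z] - q (M2 *m Z).
  have -> : q (M1 *m Z) = - '[M2 *m Z, M1 *m M1 *m Z].
    rewrite /q !dotmx_mull M1_skew M2_sym mulNmx dotmxNr !mulmxA.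
    by rewrite M12C.
  have -> : M1 *m M1 = M2 *m M2 - 4 *: M2 by rewrite M2_sqr addrC addKr.
  rewrite mulmxBl -scalemxAl !dotmx_lin /q !mulmxA; ring.
by rewrite e gerBl M2_ge0.
Qed.

(** The gap is q (Y - Z) + q (Y - W) + q (Z - W). *)
Lemma energy_add3_le n (Y Z W : 'M[R]_(m, n)) :
  q (Y + Z + W) <= 3 * (q Y + q Z + q W).
Proof.
have S (P Q : 'M[R]_(m, n)) : '[P, M2 *m Q] = '[Q, M2 *m P].
  by rewrite dotmxC dotmx_mull M2_sym.
have := M2_ge0 (Y - Z); have := M2_ge0 (Y - W); have := M2_ge0 (Z - W).
rewrite /q !mulmxDr !mulmxN !dotmx_lin (S Z Y) (S W Y) (S W Z); lra.
Qed.

(** The K-step is K - c [lf_gen] K, and [lf_adj] is the adjoint of [lf_gen]. *)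
Definition lf_gen (K : 'M[R]_(m, r)) := M1 *m K *m B + M2 *m K.
Definition lf_adj (K : 'M[R]_(m, r)) := M2 *m K - M1 *m K *m B.

Lemma lf_gen_linear k (Y Z : 'M[R]_(m, r)) :
  lf_gen (Y + k *: Z) = lf_gen Y + k *: lf_gen Z.
Proof.
rewrite /lf_gen !(mulmxDr, mulmxDl) scalerDr addrACA.
by rewrite -!scalemxAr -scalemxAl.
Qed.

(** M2 M1 is skew, as a commuting product of a symmetric and a skew matrix. This gives [lf_gen] and
    [lf_adj] equal norms, i.e. normality. *)
Lemma lf_cross (K : 'M[R]_(m, r)) : '[M2 *m K, M1 *m K *m B] = 0.
Proof.
rewrite dotmx_mull M2_sym !mulmxA -M12C; apply: dotmx_skew; last exact: B_sym.
by rewrite trmx_mul M1_skew M2_sym mulmxN M12C.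
Qed.

Lemma lf_gen_sqr (K : 'M[R]_(m, r)) :
  '[lf_gen K] = '[M1 *m K *m B] + '[M2 *m K].
Proof. rewrite /lf_gen !dotmx_lin (dotmxC _ (M2 *m K)) lf_cross; ring. Qed.

Lemma lf_adj_sqr (K : 'M[R]_(m, r)) : '[lf_adj K] = '[lf_gen K].
Proof.
rewrite lf_gen_sqr /lf_adj !dotmx_lin (dotmxC _ (M2 *m K)) lf_cross; ring.
Qed.

Lemma lf_genE (K : 'M[R]_(m, r)) : '[K, lf_gen K] = q K.
Proof. by rewrite dotmxDr dotmx_skew ?add0r ?B_sym. Qed.

Lemma lf_adjE (K : 'M[R]_(m, r)) : '[K, lf_adj K] = q K.
Proof. by rewrite dotmxDr dotmxNr dotmx_skew ?subr0 ?B_sym. Qed.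

Lemma lf_genP (K Y : 'M[R]_(m, r)) : '[lf_gen K, Y] = '[K, lf_adj Y].
Proof.
rewrite /lf_gen /lf_adj dotmxDl dotmx_mulr B_sym !dotmx_mull M1_skew.
by rewrite M2_sym mulNmx !dotmx_lin addrC mulmxA.
Qed.

Lemma lf_step_sqr (K : 'M[R]_(m, r)) :
  '[K - c *: lf_gen K] = '[K] - 2 * c * q K + c ^+ 2 * '[lf_gen K].
Proof. by rewrite dotmx_subZ_sqr lf_genE. Qed.

(* The step is a normal operator N, whence |N K|^2 = <K, N^* N K> and
   |N^* N K| = |N N K|. *)
Lemma lf_step_convex (K : 'M[R]_(m, r)) (K' := K - c *: lf_gen K) :
  2 * '[K'] <= '[K] + '[K' - c *: lf_gen K'].
Proof.
have adj_sqr : '[K' - c *: lf_adj K'] = '[K' - c *: lf_gen K'].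
  by rewrite lf_step_sqr dotmx_subZ_sqr lf_adjE lf_adj_sqr.
have adjE : '[K, K' - c *: lf_adj K'] = '[K'].
  by rewrite [in RHS]dotmxDl dotmxNl dotmxZl lf_genP dotmxDr dotmxNr dotmxZr.
have := dotmx_ge0 (K - 1 *: (K' - c *: lf_adj K')).
rewrite dotmx_subZ_sqr adjE adj_sqr; lra.
Qed.

(** By convexity the loss from K to K' is at least that of the next step, which [lf_step_sqr]
    evaluates at K'. *)
Lemma lf_step_decay (K : 'M[R]_(m, r)) (K' := K - c *: lf_gen K) :
  '[K'] <= '[K] - 2 * c * q K' + c ^+ 2 * '[lf_gen K'].
Proof.
have : 2 * '[K'] <= '[K] + '[K' - c *: lf_gen K'] by exact: lf_step_convex.
rewrite (lf_step_sqr K'); lra.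
Qed.

Variable X : 'M[R]_(m, r).
Hypothesis X_orth : orthonormal_cols X.

(** Meant for Z = T S1: it bounds all terms of second order in T by the energy of X T S1. *)
Lemma psi_gen_sqr_le (Z : 'M[R]_r) :
  '[X^T *m lf_gen (X *m Z)] + '[X^T *m (M1 *m (X *m Z)) *m C]
    <= 4 * q (X *m Z).
Proof.
have := dotmx_projl_le (lf_gen (X *m Z)) X_orth.
have := dotmx_projl_le (M1 *m (X *m Z) *m C) X_orth.
have := BC_le (M1 *m (X *m Z)).
rewrite energyE lf_gen_sqr; move: (X *m Z) => K.
by rewrite (mulmxA X^T (M1 *m K) C); lra.
Qed.

Lemma psi_gen_energy_le (S : 'M[R]_r) (K := X *m S) :
  q (X *m (X^T *m lf_gen K))
    <= 12 * ('[X^T *m (M2 *m K)] + '[M2 *m K] + '[M1 *m K *m B]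
             - '[X^T *m (M1 *m K *m B)]).
Proof.
set P := X *m (X^T *m (M1 *m K *m B)).
(* The unprojected M1 K B is split off, since [energyM1_le] bounds its energy by |M2 K|^2; only the
   projection defect remains. The factor 12 is 3 from the splitting times 4. *)
have -> : X *m (X^T *m lf_gen K) =
    X *m (X^T *m (M2 *m K)) + M1 *m K *m B + (P - M1 *m K *m B).
  by rewrite [RHS]addrACA subrr addr0 [RHS]addrC /lf_gen !mulmxDr.
apply: le_trans (energy_add3_le _ _ _) _.
have h1 := M2_le4 (X *m (X^T *m (M2 *m K))).
have h2 := M2_le4 (P - M1 *m K *m B).
have h3 : q (M1 *m K *m B) <= 4 * '[M2 *m K].
  rewrite -mulmxA; apply: le_trans (energyM1_le _) _.
  have := BC_le (M2 *m K); have := dotmx_ge0 (M2 *m K *m C).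
  rewrite mulmxA; lra.
have := dotmx_splitl (M1 *m K *m B) X_orth.
rewrite -/P -[in '[_ - P]]opprB dotmxNl dotmxNr opprK.
move: h1 h2; rewrite dotmx_isometryl // -!/(q _); lra.
Qed.

(** T is a symmetric part P plus a skew part N, so the left side is <(P - N) S, (P + N) S>. *)
Lemma psi_gen2 (S : 'M[R]_r) (T := fun Z => X^T *m lf_gen (X *m Z)) :
  '[S, T (T S)] = '[X^T *m (M2 *m (X *m S))]
                  - '[X^T *m (M1 *m (X *m S) *m B)].
Proof.
have -> : '[S, T (T S)] = '[X^T *m lf_adj (X *m S), T S].
  by rewrite {1}/T -(dotmx_mull X S) dotmxC lf_genP dotmx_mull dotmxC.
rewrite /T /lf_adj /lf_gen mulmxBr mulmxDr !dotmx_lin.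
rewrite (dotmxC (X^T *m (M2 *m _)) (X^T *m (_ *m B))); ring.
Qed.

Lemma cfl_sqr_le (x : R) : 0 <= x -> c ^+ 2 * x <= x / 36.
Proof.
move=> x0; have [c0 c6] := (c_gt0, c_le).
suff : 0 <= x * ((1 / 6 - c) * (1 / 6 + c)) by lra.
by rewrite mulr_ge0 // mulr_ge0; lra.
Qed.

Lemma psi_step_le (K0 : 'M[R]_(m, r)) (S1 : 'M[R]_r)
    (T := fun Z => X^T *m lf_gen (X *m Z)) (S2 := S1 + c *: T S1) :
  K0 - c *: lf_gen K0 = X *m S1 ->
  '[S2 - c *: T S2] + c ^+ 2 * '[X^T *m (M1 *m (X *m S2)) *m C] <= '[K0].
Proof.
move=> K1E; set K := X *m S1.
have decay : '[S1] <= '[K0] - 2 * c * q K + c ^+ 2 * '[lf_gen K].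
  rewrite -(dotmx_isometryl S1 X_orth) /K -K1E; exact: lf_step_decay.
have S2T : S2 - c *: T S2 = S1 - c ^+ 2 *: T (T S1).
  have TD : T S2 = T S1 + c *: T (T S1).
    by rewrite [LHS]/T (mulmxDr X) -scalemxAr lf_gen_linear mulmxDr -scalemxAr.
  by rewrite TD {1}/S2 scalerDr scalerA opprD addrA addrK expr2.
(* After halving, the weight at K is 3, the coefficient that |M1 K B|^2 and |M2 K|^2 receive in
   [key]. *)
have S2C : 2 * '[X^T *m (M1 *m (X *m S2)) *m C] <=
    6 * '[X^T *m (M1 *m K) *m C]
    + 3 * c ^+ 2 * '[X^T *m (M1 *m (X *m T S1)) *m C].
  have -> : X^T *m (M1 *m (X *m S2)) *m C =
      X^T *m (M1 *m K) *m C + c *: (X^T *m (M1 *m (X *m T S1)) *m C).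
    by rewrite /S2 !(mulmxDr, mulmxDl, =^~ scalemxAr, =^~ scalemxAl).
  apply: le_trans (dotmx_young _ _) _.
  by rewrite dotmxZl dotmxZr -[c ^+ 2]/(c * c) !mulrA.
have h1 : '[X^T *m (M1 *m K) *m C] <= '[M1 *m K] - '[M1 *m K *m B].
  have := dotmx_projl_le (M1 *m K *m C) X_orth.
  have := BC_le (M1 *m K); rewrite (mulmxA X^T (M1 *m K) C); lra.
have h2 := psi_gen_sqr_le (T S1); have h3 := psi_gen_energy_le S1.
have h4 := psi_gen2 S1; have h5 := energyE K.
have h6 := lf_gen_sqr K.
have h9 := dotmx_ge0 (T (T S1)); have h7 := cfl_sqr_le (dotmx_ge0 (T (T S1))).
have h8 := cfl_sqr_le (dotmx_ge0 (X^T *m (M1 *m (X *m T S1)) *m C)).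
(* As c^2 <= 1/36, the second-order terms cost at most (3/2)(48/36) = 2 times the slack in
   [psi_gen_energy_le]. The projected terms cancel, leaving at most 3 (|M1 K|^2 + |M2 K|^2) = 12 q
   K. *)
have key : '[lf_gen K] + '[X^T *m (M1 *m (X *m S2)) *m C]
    - 2 * '[S1, T (T S1)] + c ^+ 2 * '[T (T S1)] <= 12 * q K.
  move: h2 h3 h4; rewrite /= -/K -/(T S1) -/(T (T S1)) => h2 h3 ->; lra.
rewrite S2T dotmx_subZ_sqr.
have qK0 : 0 <= q K := M2_ge0 K.
have [c0 c6] := (c_gt0, c_le).
(* The surviving balance is -2 c q K + 12 c^2 q K = -12 c (1/6 - c) q K. *)
have q_ge0 : 0 <= c * ((1 / 6 - c) * q K).
  by rewrite mulr_ge0 ?(ltW c0) // mulr_ge0 //; lra.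
have := ler_wpM2l (sqr_ge0 c) key; lra.
Qed.

End Contraction.

(** * Compression of the normalized matrix to the span of [V] *)

Section Galerkin.
Variables (R : realType) (v r : nat) (a : 'M[R]_v) (V : 'M[R]_(v, r)).

Hypothesis a_sym : a^T = a.
Hypothesis a_le1 : forall n (Z : 'M[R]_(n, v)), '[Z *m a] <= '[Z].
Hypothesis V_orth : orthonormal_cols V.

Lemma galerkin_sym : (V^T *m a *m V)^T = V^T *m a *m V.
Proof. by rewrite !trmx_mul trmxK a_sym mulmxA. Qed.

(** Pythagoras for Z V^T a along [V] and its complement, then contractivity of [a]. *)
Lemma galerkin_split_le n (Z : 'M[R]_(n, r)) :
  '[Z *m (V^T *m a *m V)] + '[Z *m (V^T *m a *m (1%:M - V *m V^T))] <= '[Z].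
Proof.
rewrite -(dotmx_isometryr Z V_orth); apply: le_trans (a_le1 _).
rewrite (dotmx_splitr (_ *m a) V_orth) mulmxBr mulmx1 mulmxBr.
by rewrite !mulmxA.
Qed.

End Galerkin.

(** * Operator bounds from the supremum definition of the spectral norm *)

Section SpectralNorm.
Variable R : realType.

Lemma frobenius_normE m n (Z : 'M[R]_(m, n)) : frobenius_norm Z = Num.sqrt '[Z].
Proof. by rewrite dotmxE. Qed.

Lemma frobenius_norm_leE m n p s (Y : 'M[R]_(m, n)) (Z : 'M[R]_(p, s)) :
  (frobenius_norm Y <= frobenius_norm Z) = ('[Y] <= '[Z]).
Proof. by rewrite !frobenius_normE ler_sqrt ?dotmx_ge0. Qed.

Lemma dotmx_entry_le m n (Z : 'M[R]_(m, n)) i j : Z i j ^+ 2 <= '[Z].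
Proof.
rewrite dotmxE (bigD1 i) //= (bigD1 j) //= -addrA expr2 lerDl.
by rewrite addr_ge0 // !sumr_ge0 // => *; rewrite ?sumr_ge0 // => *;
  rewrite -expr2 sqr_ge0.
Qed.

Lemma dotmx_col m n (Z : 'M[R]_(m, n)) : '[Z] = \sum_j '[col j Z].
Proof.
rewrite dotmxE exchange_big; apply: eq_bigr => j _; rewrite dotmxE.
by apply: eq_bigr => i _; rewrite big_ord1 !mxE.
Qed.

Lemma spectral_norm_has_ub m n (B : 'M[R]_(m, n)) :
  has_ubound [set frobenius_norm (B *m v) | v in
    [set v : 'cV[R]_n | frobenius_norm v <= 1]]%classic.
Proof.
(* Entries of a vector in the unit ball are at most 1 in modulus, so absolute row sums bound the
   entries of B v. *)
pose D : 'cV[R]_m := \col_i \sum_j `|B i j|.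
exists (frobenius_norm D) => _ [v /= v_le1 <-].
rewrite frobenius_norm_leE !dotmxE.
apply: ler_sum => i _; apply: ler_sum => k _.
rewrite -!expr2 !mxE.
rewrite -[leLHS]real_normK ?num_real // ler_sqr ?nnegrE ?sumr_ge0 //.
apply: le_trans (ler_norm_sum _ _ _) _; apply: ler_sum => j _.
rewrite normrM ler_piMr // -(expr_le1 (n := 2)) // real_normK ?num_real //.
apply: le_trans (dotmx_entry_le _ _ _) _.
by rewrite -(sqr_sqrtr (dotmx_ge0 v)) -frobenius_normE exprn_ile1 //
  frobenius_normE sqrtr_ge0.
Qed.

Lemma spectral_norm_ge0 m n (B : 'M[R]_(m, n)) : 0 <= spectral_norm B.
Proof.
apply: (ub_le_sup (spectral_norm_has_ub B)).
by exists 0; rewrite /= ?mulmx0 frobenius_normE /dotmx mulmx0 mxtrace0 sqrtr0.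
Qed.

Lemma spectral_norm_mul_col m n (B : 'M[R]_(m, n)) (v : 'cV[R]_n) :
  '[B *m v] <= spectral_norm B ^+ 2 * '[v].
Proof.
have [v0|v_neq0] := eqVneq '[v] 0.
  have -> : v = 0.
    apply/matrixP => i j; apply/eqP; rewrite mxE -sqrf_eq0 eq_le sqr_ge0 andbT.
    by rewrite -v0 dotmx_entry_le.
  by rewrite mulmx0 /dotmx !mulmx0 !mxtrace0 mulr0.
have v_gt0 : 0 < '[v] by rewrite lt_def v_neq0 dotmx_ge0.
pose s := Num.sqrt '[v]; have s_gt0 : 0 < s by rewrite sqrtr_gt0.
have ss : s ^+ 2 = '[v] by rewrite sqr_sqrtr // ltW.
have Bv : Num.sqrt '[B *m (s^-1 *: v)] <= spectral_norm B.
  rewrite -frobenius_normE; apply: (ub_le_sup (spectral_norm_has_ub B)).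
  exists (s^-1 *: v) => //=; rewrite frobenius_normE dotmxZl dotmxZr -ss.
  by rewrite expr2 mulKf ?gt_eqF // mulVf ?gt_eqF // sqrtr1.
have : '[B *m (s^-1 *: v)] <= spectral_norm B ^+ 2.
  rewrite -(sqr_sqrtr (dotmx_ge0 (B *m _))) ler_sqr ?nnegrE ?sqrtr_ge0 //.
  exact: spectral_norm_ge0.
rewrite -scalemxAr dotmxZl dotmxZr mulrA -expr2 exprVn ss.
by rewrite mulrC ler_pdivrMr.
Qed.

(** By symmetry the transpose of Z A is A Z^T, to which the vector bound applies column by
    column. *)
Lemma spectral_norm_mulr m n (A : 'M[R]_n) (Z : 'M[R]_(m, n)) :
  A^T = A -> '[Z *m A] <= spectral_norm A ^+ 2 * '[Z].
Proof.
move=> A_sym; rewrite -dotmx_tr trmx_mul A_sym -(dotmx_tr Z).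
rewrite !dotmx_col mulr_sumr.
apply: ler_sum => j _; apply: le_trans (spectral_norm_mul_col _ _).
by rewrite !colE mulmxA.
Qed.

End SpectralNorm.

(** * Algebra of the periodic shifts and energy bounds for [M2] *)

Section Shifts.
Variables (R : realType) (Nx : nat).

Local Notation Ep := (shift_plus R Nx).
Local Notation Em := (shift_minus R Nx).

Lemma shift_plus_tr : Ep^T = Em.
Proof.
apply/matrixP => i j; rewrite !mxE; congr (_%:R : R); congr nat_of_bool.
by apply/eqP/eqP => ->; rewrite ?ordSK ?ord_predK.
Qed.

Lemma shift_minus_tr : Em^T = Ep. Proof. by rewrite -shift_plus_tr trmxK. Qed.

Lemma shift_plusK : Ep *m Em = 1%:M.
Proof.
apply/matrixP => i j; rewrite !mxE (bigD1 (ordS i)) //= big1 => [|k /negPf ki].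
  by rewrite !mxE eqxx mul1r addr0 ordSK eq_sym.
by rewrite !mxE ki mul0r.
Qed.

Lemma shift_minusK : Em *m Ep = 1%:M.
Proof. exact: mulmx1C shift_plusK. Qed.

Lemma M1_tr : (M1 R Nx)^T = - M1 R Nx.
Proof. by rewrite linearB /= shift_plus_tr shift_minus_tr opprB. Qed.

Lemma M2_tr : (M2 R Nx)^T = M2 R Nx.
Proof.
by rewrite !linearB /= shift_plus_tr shift_minus_tr tr_scalar_mx addrAC.
Qed.

Let shift_mul :=
  (mulmxBl, mulmxBr, mul_scalar_mx, mul_mx_scalar, shift_plusK, shift_minusK).

Lemma M1M2C : M1 R Nx *m M2 R Nx = M2 R Nx *m M1 R Nx.
Proof.
rewrite /M1 /M2 !shift_mul; apply/matrixP => i j; rewrite !mxE; ring.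
Qed.

Lemma M2_sqr : M2 R Nx *m M2 R Nx = 4 *: M2 R Nx + M1 R Nx *m M1 R Nx.
Proof.
rewrite /M1 /M2 !shift_mul; apply/matrixP => i j.
by rewrite !mxE -mulr_natr -(mulr_natr 1); ring.
Qed.

Lemma shift_sqr n (Z : 'M[R]_(Nx, n)) : '[Ep *m Z] = '[Z].
Proof. by rewrite dotmx_mull mulmxA shift_plus_tr shift_minusK mul1mx. Qed.

(** M2 = (1 - E_+)^T (1 - E_+), because E_+ is orthogonal with transpose E_-. *)
Lemma M2_energyE n (Z : 'M[R]_(Nx, n)) : '[Z, M2 R Nx *m Z] = '[Z - Ep *m Z].
Proof.
rewrite /M2 !mulmxBl mul_scalar_mx -shift_plus_tr !dotmx_lin -dotmx_mull.
by rewrite shift_sqr (dotmxC (Ep *m Z)); ring.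
Qed.

Lemma M2_energy_ge0 n (Z : 'M[R]_(Nx, n)) : 0 <= '[Z, M2 R Nx *m Z].
Proof. by rewrite M2_energyE dotmx_ge0. Qed.

Lemma M2_energy_le n (Z : 'M[R]_(Nx, n)) : '[Z, M2 R Nx *m Z] <= 4 * '[Z].
Proof.
rewrite M2_energyE; have := dotmx_ge0 (Z + Ep *m Z).
rewrite !dotmx_lin shift_sqr; lra.
Qed.

End Shifts.

(** * Reduction of the scheme to the abstract contraction *)

(** Dividing [A] by its spectral norm gives both terms the common factor nu / 2. *)
Lemma F_LF_scaled (R : realType) Nx Nv (A : 'M[R]_Nv) (dt dx : R)
    (U : 'M[R]_(Nx, Nv)) (l := spectral_norm A) :
  l != 0 -> dx != 0 ->
  dt *: F_LF A dx U = - ((cfl_number A dt dx / 2) *: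
    (M1 R Nx *m U *m (l^-1 *: A) + M2 R Nx *m U)).
Proof.
move=> l0 dx0; rewrite /F_LF /cfl_number -/l scalerBr scalerN !scalerA.
rewrite -scalemxAr scalerDr scalerA opprD; congr (- (_ *: _) - _ *: _); field.
  by rewrite l0 dx0.
by rewrite dx0.
Qed.

Theorem theorem3p3 (R : realType) (Nx Nv r : nat) (A : 'M[R]_Nv) (dt dx : R)
    (X : nat -> 'M[R]_(Nx, r)) (S : nat -> 'M[R]_r) (V : nat -> 'M[R]_(Nv, r))
    (U : nat -> 'M[R]_(Nx, Nv))
    (r_le : (r <= minn Nx Nv)%N)
    (A_sym : A^T = A)
    (dt_gt0 : 0 < dt) (dx_gt0 : 0 < dx)
    (scheme : psi_iterates A dt dx X S V)
    (defU : forall n, U n = X n *m S n *m (V n)^T)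
    (nu_gt0 : 0 < cfl_number A dt dx)
    (nu_le : cfl_number A dt dx <= 1 / 3) :
  forall n : nat, frobenius_norm (U n.+1) <= frobenius_norm (U n).
Proof.
move=> n; case: scheme => _ V0_orth step.
have V_orth : orthonormal_cols (V n).
  by case: n => // n; have [S1 [_ []]] := step n.
have [S1 [[K1E X_orth _] [L1E V1_orth _]]] := step n.
have dx_neq0 : dx != 0 by rewrite gt_eqF.
have l_neq0 : spectral_norm A != 0.
  by apply: contraTneq nu_gt0 => l0; rewrite /cfl_number l0 mul0r ltxx.
set a := (spectral_norm A)^-1 *: A.
have a_sym : a^T = a by rewrite linearZ /= A_sym.
have a_le1 k (Z : 'M[R]_(k, Nv)) : '[Z *m a] <= '[Z].
  rewrite -scalemxAr dotmxZl dotmxZr mulrA -expr2 exprVn mulrC.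
  rewrite ler_pdivrMr ?exprn_even_gt0 // mulrC; exact: spectral_norm_mulr.
pose c := cfl_number A dt dx / 2; pose B := (V n)^T *m a *m V n.
pose G (K : 'M[R]_(Nx, r)) := lf_gen (M1 R Nx) (M2 R Nx) B K.
have FE (Z : 'M[R]_(Nx, r)) :
    dt *: (F_LF A dx (Z *m (V n)^T) *m V n) = - (c *: G Z).
  rewrite scalemxAl F_LF_scaled // mulNmx -scalemxAl mulmxDl -!mulmxA V_orth.
  by rewrite mulmx1 /G /lf_gen /B !mulmxA.
pose T Z := (X n.+1)^T *m G (X n.+1 *m Z); pose S2 := S1 + c *: T S1.
pose L := S2 *m (V n)^T.
pose L1 := L - c *: ((X n.+1)^T *m
  (M1 R Nx *m (X n.+1 *m L) *m a + M2 R Nx *m (X n.+1 *m L))).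
have {}L1E : S n.+1 *m (V n.+1)^T = L1.
  have /(congr1 trmx) := L1E; rewrite trmxK trmx_mul trmxK => <-.
  have -> : S1 - dt *: ((X n.+1)^T *m
      F_LF A dx (X n.+1 *m S1 *m (V n)^T) *m V n) = S2.
    by rewrite -mulmxA scalemxAr FE mulmxN opprK -scalemxAr.
  by rewrite scalemxAr F_LF_scaled // mulmxN -scalemxAr.
have L1V : L1 *m V n = S2 - c *: T S2.
  rewrite /L1 mulmxBl -scalemxAl -(mulmxA (X n.+1)^T) mulmxDl /T /G /lf_gen /B.
  by rewrite /L -!mulmxA V_orth mulmx1.
pose Q := 1%:M - V n *m (V n)^T.
have VQ : (V n)^T *m Q = 0 by rewrite mulmxBr mulmx1 mulmxA V_orth mul1mx subrr.
(* V^T Q = 0 removes L and the [M2] term, so only transport leaves the span of the old V. *)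
have L1C : L1 - L1 *m V n *m (V n)^T = - (c *: ((X n.+1)^T *m
    (M1 R Nx *m (X n.+1 *m S2)) *m ((V n)^T *m a *m Q))).
  have -> : L1 - L1 *m V n *m (V n)^T = L1 *m Q.
    by rewrite mulmxBr mulmx1 mulmxA.
  rewrite /L1 mulmxBl -scalemxAl -(mulmxA (X n.+1)^T _ Q) (mulmxDl _ _ Q).
  rewrite /L -!mulmxA VQ.
  by rewrite !mulmx0 addr0 sub0r.
rewrite frobenius_norm_leE !defU.
rewrite (dotmx_isometryr _ V_orth) -mulmxA (dotmx_isometryl _ X_orth) L1E.
rewrite (dotmx_splitr L1 V_orth) L1C L1V dotmxNl dotmxNr opprK dotmxZl dotmxZr.
rewrite mulrA -expr2.
(* The squared norms are now |L1|^2, split along the old V, and |X^n S^n|^2. *)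
apply: psi_step_le => //.
- exact: M1_tr.
- exact: M2_tr.
- exact: M1M2C.
- exact: M2_sqr.
- by move=> *; apply: M2_energy_ge0.
- by move=> *; apply: M2_energy_le.
- exact: galerkin_sym.
- by move=> *; apply: galerkin_split_le.
- by rewrite divr_gt0.
- by move: nu_le; rewrite /c; lra.
- by rewrite -K1E FE.
Qed.
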